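(* Let $X\subseteq\mathbb{R}^3$ be a finite subset. Then the projection map $p\colon\mathcal{R}(X)\to\mathcal{S}(X)$ is a $\pi_1$-surjection; that is, for every basepoint $x\in\mathcal{R}(X)$ the induced homomorphism $p_*\colon\pi_1(\mathcal{R}(X),x)\to\pi_1(\mathcal{S}(X),p(x))$ is surjective.
   Context: $\mathbb{R}^n$ carries the Euclidean metric; $\mathrm{diam}(Y)$ and $\mathrm{conv}(Y)$ denote the diameter and convex hull of $Y\subseteq\mathbb{R}^n$. For $X\subseteq\mathbb{R}^n$, the Rips complex $\mathcal{R}(X)$ (at distance scale $1$) is the abstract simplicial complex with vertex set $X$ in which a finite nonempty set $Y\subseteq X$ is a face if and only if $\mathrm{diam}(Y)<1$. An abstract simplicial complex is identified with its geometric realization. The projection map $p\colon\mathcal{R}(X)\to\mathbb{R}^n$ sends each vertex to the corresponding point of $X$ and is extended linearly (affinely) over each simplex. The shadow $\mathcal{S}(X)\subseteq\mathbb{R}^n$ is the image of $p$, with the subspace topology; equivalently, $\mathcal{S}(X)$ is the union of the sets $\mathrm{conv}(Y)$ over all nonempty $Y\subseteq X$ with $|Y|\le n+1$ and $\mathrm{diam}(Y)<1$. *)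

(* Defs.v *)
From HB Require Import structures.
From mathcomp Require Import all_boot all_order all_algebra generic_quotient.
From mathcomp Require Import finmap lra.
From mathcomp Require Import boolp classical_sets functions reals ereal.
From mathcomp Require Import topology normedtype homotopy.

Set Implicit Arguments.
Unset Strict Implicit.
Unset Printing Implicit Defensive.

Import Order.TTheory GRing.Theory Num.Theory.
Import numFieldNormedType.Exports.

Local Open Scope classical_set_scope.
Local Open Scope ring_scope.
Local Open Scope quotient_scope.

Lemma continuous_if_le (R : realType) (S T : topologicalType) (u : S -> R)
    (a : R) (F G : S -> T) :
  continuous u -> continuous F -> continuous G ->
  (forall s, u s = a -> F s = G s) ->
  continuous (fun s => if u s <= a then F s else G s).
Proof.
move=> cu cF cG FG.
set h := fun s => _.
pose A := u @^-1` [set r | r <= a]; pose B := u @^-1` [set r | a <= r].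
have cA : closed A by apply: (closed_comp _ (@closed_le R a)) => s _; exact: cu.
have cB : closed B by apply: (closed_comp _ (@closed_ge R a)) => s _; exact: cu.
have ABT : A `|` B = setT.
  apply/seteqP; split=> // s _; rewrite /A /B /=.
  by case: (leP (u s) a) => [|/ltW]; [left|right].
have hA : {within A, continuous h}.
  apply: (subspace_eq_continuous _ (continuous_subspaceT cF)) => s.
  by move=> /set_mem; rewrite /A /h /from_subspace /= => ->.
have hB : {within B, continuous h}.
  apply: (subspace_eq_continuous _ (continuous_subspaceT cG)) => s.
  move=> /set_mem; rewrite /B /h /from_subspace /= => aus; case: ifP => // usa.
  by rewrite FG //; apply/le_anti; rewrite aus usa.
have := withinU_continuous cA cB hA hB.
by rewrite ABT => hT; exact/continuous_subspace_setT.
Qed.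

Lemma continuous_pair (S T U : topologicalType) (f : S -> T) (g : S -> U) :
  continuous f -> continuous g -> continuous (fun s => (f s, g s)).
Proof. by move=> cf cg s; apply: cvg_pair; [exact: cf|exact: cg]. Qed.

Lemma continuous_compose (S T U : topologicalType) (f : S -> T) (g : T -> U) :
  continuous f -> continuous g -> continuous (fun s => g (f s)).
Proof. by move=> cf cg s; apply: continuous_comp; [exact: cf|exact: cg]. Qed.

Lemma continuous_mull (R : realType) (S : topologicalType) (a : R) (u : S -> R) :
  continuous u -> continuous (fun s => a * u s).
Proof. by move=> cu s; apply: cvgM; [exact: cvg_cst|exact: cu]. Qed.

Lemma continuous_addr (R : realType) (S : topologicalType) (a : R) (u : S -> R) :
  continuous u -> continuous (fun s => u s + a).
Proof. by move=> cu s; apply: cvgD; [exact: cu|exact: cvg_cst]. Qed.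

Lemma continuous_subl (R : realType) (S : topologicalType) (a : R) (u : S -> R) :
  continuous u -> continuous (fun s => a - u s).
Proof. by move=> cu s; apply: cvgB; [exact: cvg_cst|exact: cu]. Qed.

Lemma continuous_minr (R : realType) (S : topologicalType) (u v : S -> R) :
  continuous u -> continuous v -> continuous (fun s => Num.min (u s) (v s)).
Proof.
by move=> cu cv s; apply: (@continuous_min R S u v); [exact: cu|exact: cv].
Qed.

Definition unit_itv (R : realType) : Type := set_type (`[0, 1]%classic : set R).

HB.instance Definition _ (R : realType) := Topological.on (unit_itv R).

Section UnitInterval.
Context {R : realType}.
Local Notation I := (unit_itv R).

Definition itv_val (s : I) : R := set_val s.

Lemma itv_val_inj : injective itv_val.
Proof. exact: val_inj. Qed.

Lemma itv_val_bound (s : I) : 0 <= itv_val s <= 1.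
Proof. by have := set_valP s; rewrite /= in_itv. Qed.

Lemma itv_val_continuous : continuous itv_val.
Proof. exact: initial_continuous. Qed.

(* Nearest-point retraction of the real line onto the unit interval. *)
Definition clamp_val (r : R) : R := Num.max 0 (Num.min 1 r).

Lemma clamp_subproof (r : R) : clamp_val r \in `[0, 1]%classic.
Proof.
by rewrite inE /= in_itv /= /clamp_val le_max lexx /= ge_max ler01 ge_min lexx.
Qed.

Definition clamp (r : R) : I := exist _ (clamp_val r) (clamp_subproof r).

Lemma itv_val_clamp (r : R) : itv_val (clamp r) = clamp_val r.
Proof. by []. Qed.

Lemma clampE (r : R) : 0 <= r <= 1 -> itv_val (clamp r) = r.
Proof.
move=> /andP[r0 r1]; rewrite itv_val_clamp /clamp_val.
by rewrite (min_idPr r1) (max_idPr r0).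
Qed.

Lemma itv_valK : cancel itv_val clamp.
Proof. by move=> s; apply: itv_val_inj; rewrite clampE // itv_val_bound. Qed.

Lemma clamp_continuous : continuous clamp.
Proof.
apply: continuous_comp_initial => r /=.
apply: continuous_max; first exact: cvg_cst.
by apply: continuous_min; [exact: cvg_cst|exact: cvg_id].
Qed.

Lemma clamp01 : clamp 0 != clamp 1.
Proof.
apply/eqP => /(congr1 itv_val).
by rewrite !clampE ?lexx ?ler01 // => /eqP; rewrite eq_sym oner_eq0.
Qed.

HB.instance Definition _ := isBiPointed.Build I clamp01.

Lemma itv_val0 : itv_val (zero : I) = 0.
Proof. by rewrite /zero /= clampE // lexx ler01. Qed.

Lemma itv_val1 : itv_val (one : I) = 1.
Proof. by rewrite /one /= clampE // lexx ler01. Qed.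

Lemma clamp_le0 (r : R) : r <= 0 -> clamp r = zero.
Proof.
move=> r0; apply: itv_val_inj; rewrite itv_val0 itv_val_clamp /clamp_val.
by rewrite (min_idPr (le_trans r0 ler01)) (max_idPl r0).
Qed.

Lemma clamp_ge1 (r : R) : 1 <= r -> clamp r = one.
Proof.
move=> r1; apply: itv_val_inj; rewrite itv_val1 itv_val_clamp /clamp_val.
by rewrite (min_idPl r1) (max_idPr ler01).
Qed.

Lemma itv_val_fst_continuous (S : topologicalType) :
  continuous (fun z : I * S => itv_val z.1).
Proof.
by apply: continuous_compose itv_val_continuous => z; exact: cvg_fst.
Qed.

Lemma itv_val_snd_continuous (S : topologicalType) :
  continuous (fun z : S * I => itv_val z.2).
Proof.
by apply: continuous_compose itv_val_continuous => z; exact: cvg_snd.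
Qed.

Lemma clamp_comp_continuous (S : topologicalType) (u : S -> R) :
  continuous u -> continuous (fun s => clamp (u s)).
Proof. by move=> cu s; apply: continuous_comp; [exact: cu|exact: clamp_continuous]. Qed.

End UnitInterval.

Section PathHomotopy.
Context {R : realType} {T : topologicalType}.
Local Notation I := (unit_itv R).

Definition homotopic (x y : T) (f g : {path I from x to y}) : Prop :=
  exists H : I * I -> T,
    [/\ continuous H,
        forall s, H (s, zero) = f s,
        forall s, H (s, one) = g s,
        forall t, H (zero, t) = x &
        forall t, H (one, t) = y].

Lemma homotopic_refl (x y : T) (f : {path I from x to y}) : homotopic f f.
Proof.
exists (f \o fst); split=> // [z|t|t] /=; rewrite ?path_zero ?path_one //.
by apply: continuous_comp; [exact: cvg_fst|exact: cts_fun].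
Qed.

Lemma homotopic_sym (x y : T) (f g : {path I from x to y}) :
  homotopic f g -> homotopic g f.
Proof.
case=> H [cH Hf Hg Hx Hy].
exists (fun z => H (z.1, clamp (1 - itv_val z.2))); split=> //=.
- apply: (continuous_compose _ cH); apply: continuous_pair;
  first by move=> ?; exact: cvg_fst.
  apply: (clamp_comp_continuous (u := fun z : I * I => 1 - itv_val z.2)).
  exact: continuous_subl (@itv_val_snd_continuous _ _).
- by move=> s; rewrite itv_val0 subr0.
- by move=> s; rewrite itv_val1 subrr.
Qed.

Lemma homotopic_trans (x y : T) (f g h : {path I from x to y}) :
  homotopic f g -> homotopic g h -> homotopic f h.
Proof.
case=> [H [cH Hf Hg Hx Hy]] [K [cK Kg Kh Kx Ky]].
have cv2 : continuous (fun z : I * I => 2 * itv_val z.2).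
  exact: continuous_mull (@itv_val_snd_continuous _ _).
exists (fun z => if itv_val z.2 <= 2^-1 then H (z.1, clamp (2 * itv_val z.2))
                 else K (z.1, clamp (2 * itv_val z.2 - 1))); split=> /=.
- apply: (continuous_if_le (u := fun z : I * I => itv_val z.2)).
  + exact: itv_val_snd_continuous.
  + apply: (continuous_compose _ cH); apply: continuous_pair;
    first by move=> ?; exact: cvg_fst.
    exact: (clamp_comp_continuous (u := fun z : I * I => 2 * itv_val z.2)).
  + apply: (continuous_compose _ cK); apply: continuous_pair;
    first by move=> ?; exact: cvg_fst.
    apply: (clamp_comp_continuous (u := fun z : I * I => 2 * itv_val z.2 - 1)).
    exact: continuous_addr cv2.
  + by move=> z ->; rewrite divff ?pnatr_eq0 // subrr Hg Kg.
- by move=> s; rewrite itv_val0 mulr0 invr_ge0 ler0n Hf.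
- move=> s; rewrite itv_val1 mulr1 ifF; last by apply/negbTE; rewrite -ltNge; lra.
  by rewrite -[2 - 1]/(1 + 1 - 1) addrK Kh.
- by move=> t; case: ifP.
- by move=> t; case: ifP.
Qed.

Lemma homotopic_reparam (x y x' y' : T) (c : {path I from x' to y'})
    (phi psi : I -> I) (f g : {path I from x to y}) :
  continuous phi -> continuous psi ->
  phi zero = psi zero -> phi one = psi one ->
  (forall s, f s = c (phi s)) -> (forall s, g s = c (psi s)) ->
  homotopic f g.
Proof.
move=> cphi cpsi e0 e1 fE gE.
pose m (z : I * I) : R := (1 - itv_val z.2) * itv_val (phi z.1)
                           + itv_val z.2 * itv_val (psi z.1).
have c2 : continuous (fun z : I * I => itv_val z.2).
  exact: itv_val_snd_continuous.
have c1 (u : I -> I) : continuous u -> continuous (fun z : I * I => itv_val (u z.1)).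
  move=> cu; apply: continuous_compose itv_val_continuous.
  by apply: continuous_compose cu => z; exact: cvg_fst.
have cm : continuous m.
  move=> z; apply: cvgD; apply: cvgM; [|exact: c1|exact: c2|exact: c1].
  exact: (continuous_subl c2).
exists (fun z => c (clamp (m z))); split.
- by apply: continuous_compose (@cts_fun _ _ c); exact: clamp_comp_continuous.
- by move=> s; rewrite /m /= itv_val0 subr0 mul1r mul0r addr0 itv_valK fE.
- by move=> s; rewrite /m /= itv_val1 subrr mul1r mul0r add0r itv_valK gE.
- by move=> t; rewrite /m /= -e0 -mulrDl subrK mul1r itv_valK -fE path_zero.
- by move=> t; rewrite /m /= -e1 -mulrDl subrK mul1r itv_valK -fE path_one.
Qed.

Definition cat_fun (f g : I -> T) (s : I) : T :=
  if itv_val s <= 2^-1 then f (clamp (2 * itv_val s))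
  else g (clamp (2 * itv_val s - 1)).

Section Concatenation.
Context (x y z : T) (f : {path I from x to y}) (g : {path I from y to z}).

Lemma cat_fun_continuous : continuous (cat_fun f g).
Proof.
have cv2 : continuous (fun s : I => 2 * itv_val s).
  exact: continuous_mull itv_val_continuous.
apply: continuous_if_le.
- exact: itv_val_continuous.
- apply: continuous_compose (@cts_fun _ _ f).
  exact: (clamp_comp_continuous (u := fun s => 2 * itv_val s)).
- apply: continuous_compose (@cts_fun _ _ g).
  apply: (clamp_comp_continuous (u := fun s => 2 * itv_val s - 1)).
  exact: continuous_addr cv2.
- by move=> s ->; rewrite divff ?pnatr_eq0 // subrr path_one path_zero.
Qed.

Lemma cat_fun_zero : cat_fun f g zero = x.
Proof. by rewrite /cat_fun itv_val0 mulr0 invr_ge0 ler0n path_zero. Qed.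

Lemma cat_fun_one : cat_fun f g one = z.
Proof.
rewrite /cat_fun itv_val1 mulr1 ifF; last by apply/negbTE; rewrite -ltNge; lra.
by rewrite -[2 - 1]/(1 + 1 - 1) addrK path_one.
Qed.

HB.instance Definition _ :=
  isContinuous.Build _ _ (cat_fun f g) cat_fun_continuous.
HB.instance Definition _ :=
  isPath.Build I T x z (cat_fun f g) cat_fun_zero cat_fun_one.

Definition cat_path : {path I from x to z} := cat_fun f g.

End Concatenation.

Definition rev_fun (f : I -> T) (s : I) : T := f (clamp (1 - itv_val s)).

Section Reversal.
Context (x y : T) (f : {path I from x to y}).

Lemma rev_fun_continuous : continuous (rev_fun f).
Proof.
apply: continuous_compose (@cts_fun _ _ f).
apply: (clamp_comp_continuous (u := fun s => 1 - itv_val s)).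
exact: continuous_subl itv_val_continuous.
Qed.

Lemma rev_fun_zero : rev_fun f zero = y.
Proof. by rewrite /rev_fun itv_val0 subr0 path_one. Qed.

Lemma rev_fun_one : rev_fun f one = x.
Proof. by rewrite /rev_fun itv_val1 subrr path_zero. Qed.

HB.instance Definition _ :=
  isContinuous.Build _ _ (rev_fun f) rev_fun_continuous.
HB.instance Definition _ :=
  isPath.Build I T y x (rev_fun f) rev_fun_zero rev_fun_one.

Definition rev_path : {path I from y to x} := rev_fun f.

End Reversal.

Definition const_path (x : T) : {path I from x to x} := cst x.

Lemma homotopic_cat (x y z : T) (f f' : {path I from x to y})
    (g g' : {path I from y to z}) :
  homotopic f f' -> homotopic g g' ->
  homotopic (cat_path f g) (cat_path f' g').
Proof.
case=> [H [cH Hf Hf' Hx Hy]] [K [cK Kg Kg' Ky Kz]].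
have cv2 : continuous (fun z : I * I => 2 * itv_val z.1).
  exact: continuous_mull (@itv_val_fst_continuous _ _).
exists (fun z => if itv_val z.1 <= 2^-1 then H (clamp (2 * itv_val z.1), z.2)
                 else K (clamp (2 * itv_val z.1 - 1), z.2)); split=> /=.
- apply: (continuous_if_le (u := fun z : I * I => itv_val z.1)).
  + exact: itv_val_fst_continuous.
  + apply: (continuous_compose _ cH); apply: continuous_pair;
    last by move=> ?; exact: cvg_snd.
    exact: (clamp_comp_continuous (u := fun z : I * I => 2 * itv_val z.1)).
  + apply: (continuous_compose _ cK); apply: continuous_pair;
    last by move=> ?; exact: cvg_snd.
    apply: (clamp_comp_continuous (u := fun z : I * I => 2 * itv_val z.1 - 1)).
    exact: continuous_addr cv2.
  + by move=> w ->; rewrite divff ?pnatr_eq0 // subrr Hy Ky.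
- by move=> s; rewrite Hf Kg.
- by move=> s; rewrite Hf' Kg'.
- by move=> t; rewrite itv_val0 mulr0 invr_ge0 ler0n Hx.
- move=> s; rewrite itv_val1 mulr1 ifF; last by apply/negbTE; rewrite -ltNge; lra.
  by rewrite -[2 - 1]/(1 + 1 - 1) addrK Kz.
Qed.

Lemma homotopic_rev (x y : T) (f g : {path I from x to y}) :
  homotopic f g -> homotopic (rev_path f) (rev_path g).
Proof.
case=> H [cH Hf Hg Hx Hy].
exists (fun z => H (clamp (1 - itv_val z.1), z.2)); split=> //=.
- apply: (continuous_compose _ cH); apply: continuous_pair;
  last by move=> ?; exact: cvg_snd.
  apply: (clamp_comp_continuous (u := fun z : I * I => 1 - itv_val z.1)).
  exact: continuous_subl (@itv_val_fst_continuous _ _).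
- by move=> s; rewrite Hf.
- by move=> s; rewrite Hg.
- by move=> t; rewrite itv_val0 subr0 Hy.
- by move=> t; rewrite itv_val1 subrr Hx.
Qed.

Lemma cat_path1p (x y : T) (f : {path I from x to y}) :
  homotopic (cat_path (const_path x) f) f.
Proof.
apply: (homotopic_reparam (c := f)
          (phi := fun s => clamp (2 * itv_val s - 1)) (psi := id)) => //=.
- apply: (clamp_comp_continuous (u := fun s => 2 * itv_val s - 1)).
  exact: continuous_addr (continuous_mull itv_val_continuous).
- by move=> s; exact: cvg_id.
- by rewrite itv_val0 mulr0 clamp_le0; [|lra].
- by rewrite itv_val1 clamp_ge1; [|lra].
- move=> s; rewrite /cat_path /= /cat_fun; case: ifP => // sh.
  by rewrite [X in _ = f X]clamp_le0; [rewrite path_zero|lra].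
Qed.

Lemma cat_pathp1 (x y : T) (f : {path I from x to y}) :
  homotopic (cat_path f (const_path y)) f.
Proof.
apply: (homotopic_reparam (c := f)
          (phi := fun s => clamp (2 * itv_val s)) (psi := id)) => //=.
- apply: (clamp_comp_continuous (u := fun s => 2 * itv_val s)).
  exact: continuous_mull itv_val_continuous.
- by move=> s; exact: cvg_id.
- by rewrite itv_val0 mulr0.
- by rewrite itv_val1 clamp_ge1; [|lra].
- move=> s; rewrite /cat_path /= /cat_fun; case: ifPn => //; rewrite -ltNge => sh.
  by rewrite [X in _ = f X]clamp_ge1; [rewrite path_one|lra].
Qed.

Lemma cat_pathA (x y z w : T) (f : {path I from x to y})
    (g : {path I from y to z}) (h : {path I from z to w}) :
  homotopic (cat_path f (cat_path g h)) (cat_path (cat_path f g) h).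
Proof.
apply: homotopic_sym.
pose u (s : I) : R :=
  Num.min (2 * itv_val s) (Num.min (itv_val s + 4^-1) (2^-1 * (itv_val s + 1))).
apply: (homotopic_reparam (c := cat_path f (cat_path g h))
          (phi := fun s => clamp (u s)) (psi := id)) => //=.
- apply: clamp_comp_continuous; apply: continuous_minr.
    exact: (continuous_mull itv_val_continuous).
  apply: continuous_minr; first exact: (continuous_addr itv_val_continuous).
  exact: (continuous_mull (continuous_addr itv_val_continuous)).
- by move=> s; exact: cvg_id.
- by rewrite clamp_le0 // /u itv_val0 mulr0 ge_min lexx.
- by rewrite clamp_ge1 // /u itv_val1 !le_min; apply/and3P; split; lra.
- move=> s; rewrite /cat_path /= /cat_fun /u.
  have /andP[s0 s1] := itv_val_bound s; move: (itv_val s) s0 s1 => r r0 r1.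
  case: (leP r 2^-1) => rh.
    rewrite (clampE (r := 2 * r)); last lra.
    case: (leP (2 * r) 2^-1) => rq.
      have -> : Num.min (2 * r) (Num.min (r + 4^-1) (2^-1 * (r + 1))) = 2 * r.
        by rewrite !minEle; do !case: ifPn; rewrite -?ltNge; lra.
      by rewrite clampE ?rq //; lra.
    have -> : Num.min (2 * r) (Num.min (r + 4^-1) (2^-1 * (r + 1))) = r + 4^-1.
      by rewrite !minEle; do !case: ifPn; rewrite -?ltNge; lra.
    rewrite clampE; last lra.
    rewrite ifF; last by apply/negbTE; rewrite -ltNge; lra.
    rewrite clampE; last lra.
    rewrite ifT; last lra.
    by congr (g (clamp _)); lra.
  have -> : Num.min (2 * r) (Num.min (r + 4^-1) (2^-1 * (r + 1))) = 2^-1 * (r + 1).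
    by rewrite !minEle; do !case: ifPn; rewrite -?ltNge; lra.
  rewrite clampE; last lra.
  rewrite ifF; last by apply/negbTE; rewrite -ltNge; lra.
  rewrite clampE; last lra.
  rewrite ifF; last by apply/negbTE; rewrite -ltNge; lra.
  by congr (h (clamp _)); lra.
Qed.

Lemma cat_path_rev (x y : T) (f : {path I from x to y}) :
  homotopic (cat_path f (rev_path f)) (const_path x).
Proof.
pose u (s : I) : R := Num.min (2 * itv_val s) (2 - 2 * itv_val s).
have cv2 : continuous (fun s : I => 2 * itv_val s).
  exact: continuous_mull itv_val_continuous.
apply: (homotopic_reparam (c := f)
          (phi := fun s => clamp (u s)) (psi := fun=> zero)) => //=.
- apply: clamp_comp_continuous; apply: continuous_minr; first exact: cv2.
  exact: (continuous_subl cv2).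
- exact: cst_continuous.
- by rewrite clamp_le0 // /u itv_val0 mulr0 ge_min lexx.
- by rewrite clamp_le0 // /u itv_val1 ge_min; apply/orP; right; lra.
- move=> s; rewrite /cat_path /= /cat_fun /rev_path /= /rev_fun /u.
  have /andP[s0 s1] := itv_val_bound s; move: (itv_val s) s0 s1 => r r0 r1.
  case: leP => rh.
    by congr (f (clamp _)); rewrite minEle; case: ifPn; rewrite -?ltNge; lra.
  rewrite clampE; last lra.
  by congr (f (clamp _)); rewrite minEle; case: ifPn; rewrite -?ltNge; lra.
- by move=> s; rewrite path_zero.
Qed.

Lemma cat_rev_path (x y : T) (f : {path I from x to y}) :
  homotopic (cat_path (rev_path f) f) (const_path y).
Proof.
have -> : cat_path (rev_path f) f = cat_path (rev_path f) (rev_path (rev_path f)).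
  congr cat_path; apply/path_eqP => s; rewrite /rev_path /= /rev_fun.
  have /andP[s0 s1] := itv_val_bound s.
  by rewrite clampE ?subKr ?itv_valK //; lra.
exact: cat_path_rev.
Qed.

End PathHomotopy.

Section FundamentalGroup.
Context (R : realType) (T : topologicalType) (x : T).
Local Notation I := (unit_itv R).

Definition loop_equiv (f g : {path I from x to x}) : bool := `[< homotopic f g >].

Lemma loop_equiv_refl : reflexive loop_equiv.
Proof. by move=> f; apply/asboolP; exact: homotopic_refl. Qed.

Lemma loop_equiv_sym : symmetric loop_equiv.
Proof. by move=> f g; apply/asboolP/asboolP; exact: homotopic_sym. Qed.

Lemma loop_equiv_trans : transitive loop_equiv.
Proof.
by move=> g f h /asboolP fg /asboolP gh; apply/asboolP/(homotopic_trans fg gh).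
Qed.

Canonical loop_equiv_equiv :=
  EquivRel loop_equiv loop_equiv_refl loop_equiv_sym loop_equiv_trans.

Definition pi1 : Type := {eq_quot loop_equiv}.

HB.instance Definition _ := Choice.on pi1.
HB.instance Definition _ := EqQuotient.on pi1.

Definition pi1_class (f : {path I from x to x}) : pi1 := \pi_pi1 f.

Lemma pi1_classP (f g : {path I from x to x}) :
  pi1_class f = pi1_class g <-> homotopic f g.
Proof. by split=> [/eqmodP/asboolP //|fg]; apply/eqmodP/asboolP. Qed.

Lemma pi1_reprK (a : pi1) : pi1_class (repr a) = a.
Proof. exact: reprK. Qed.

Lemma pi1_repr_class (f : {path I from x to x}) :
  homotopic (repr (pi1_class f)) f.
Proof. by apply/pi1_classP; rewrite pi1_reprK. Qed.

Definition pi1_one : pi1 := pi1_class (const_path x).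
Definition pi1_mul (a b : pi1) : pi1 := pi1_class (cat_path (repr a) (repr b)).
Definition pi1_inv (a : pi1) : pi1 := pi1_class (rev_path (repr a)).

Lemma pi1_mul_class (f g : {path I from x to x}) :
  pi1_mul (pi1_class f) (pi1_class g) = pi1_class (cat_path f g).
Proof. by apply/pi1_classP/homotopic_cat; exact: pi1_repr_class. Qed.

Lemma pi1_inv_class (f : {path I from x to x}) :
  pi1_inv (pi1_class f) = pi1_class (rev_path f).
Proof. by apply/pi1_classP/homotopic_rev; exact: pi1_repr_class. Qed.

Lemma pi1_mulA : associative pi1_mul.
Proof.
move=> a b c; rewrite -(pi1_reprK a) -(pi1_reprK b) -(pi1_reprK c).
by rewrite !pi1_mul_class; apply/pi1_classP/cat_pathA.
Qed.

Lemma pi1_mul1g : left_id pi1_one pi1_mul.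
Proof.
move=> a; rewrite -(pi1_reprK a) pi1_mul_class.
exact/pi1_classP/cat_path1p.
Qed.

Lemma pi1_mulg1 : right_id pi1_one pi1_mul.
Proof.
move=> a; rewrite -(pi1_reprK a) pi1_mul_class.
exact/pi1_classP/cat_pathp1.
Qed.

Lemma pi1_mulVg : left_inverse pi1_one pi1_inv pi1_mul.
Proof.
move=> a; rewrite -(pi1_reprK a) pi1_inv_class pi1_mul_class.
exact/pi1_classP/cat_rev_path.
Qed.

Lemma pi1_mulgV : right_inverse pi1_one pi1_inv pi1_mul.
Proof.
move=> a; rewrite -(pi1_reprK a) pi1_inv_class pi1_mul_class.
exact/pi1_classP/cat_path_rev.
Qed.

HB.instance Definition _ := isGroup.Build pi1
  pi1_mulA pi1_mul1g pi1_mulg1 pi1_mulVg pi1_mulgV.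

End FundamentalGroup.

Section InducedMap.
Context (R : realType) (T U : topologicalType) (p : continuousType T U).
Local Notation I := (unit_itv R).

Definition map_path (x y : T) (f : {path I from x to y}) :
  {path I from p x to p y} := p \o f.

Lemma homotopic_map (x y : T) (f g : {path I from x to y}) :
  homotopic f g -> homotopic (map_path f) (map_path g).
Proof.
case=> H [cH Hf Hg Hx Hy]; exists (p \o H); split=> /= [|s|s|t|t].
- by move=> z; apply: continuous_comp; [exact: cH|exact: cts_fun].
- by rewrite Hf.
- by rewrite Hg.
- by rewrite Hx.
- by rewrite Hy.
Qed.

Context (x : T).

Definition pi1_map (a : pi1 R x) : pi1 R (p x) := pi1_class (map_path (repr a)).

Lemma pi1_map_class (f : {path I from x to x}) :
  pi1_map (pi1_class f) = pi1_class (map_path f).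
Proof. exact/pi1_classP/homotopic_map/pi1_repr_class. Qed.

Lemma pi1_map1 : pi1_map 1%g = 1%g.
Proof.
rewrite -[1%g in LHS]/(pi1_one R x) pi1_map_class.
by congr pi1_class; apply/path_eqP.
Qed.

Lemma pi1_mapM : {morph pi1_map : a b / (a * b)%g}.
Proof.
move=> a b; rewrite -(pi1_reprK a) -(pi1_reprK b).
rewrite -[(_ * _)%g in LHS]/(pi1_mul _ _) -[RHS]/(pi1_mul _ _).
rewrite pi1_mul_class !pi1_map_class pi1_mul_class; congr pi1_class.
by apply/path_eqP => s; rewrite /= /cat_path /cat_fun /=; case: ifP.
Qed.

HB.instance Definition _ := isMultiplicative.Build _ _ pi1_map pi1_mapM.
HB.instance Definition _ :=
  Multiplicative_isUMagmaMorphism.Build _ _ pi1_map pi1_map1.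

End InducedMap.

Definition pi1_surjection (R : realType) (T U : topologicalType)
    (p : continuousType T U) : Prop :=
  forall (x : T) (b : pi1 R (p x)), exists a : pi1 R x, pi1_map p a = b.

Arguments pi1_surjection R {T U} p.

Record simplicial_complex (V : finType) := SimplicialComplex {
  face : set {set V};
  face_neq0 : forall Y, face Y -> Y != finset.set0;
  face_sub : forall Y Z : {set V},
    face Y -> Z \subset Y -> Z != finset.set0 -> face Z;
  face_vertex : forall v, face [set v]%SET }.

Section GeometricRealization.
Context (R : realType) (V : finType) (K : simplicial_complex V).

(* Barycentric coordinates. As V is finite, the topology inherited from the
   product R^V is the usual (coherent) topology on the realization. *)
Definition realization : set {ptws V -> R} :=
  [set t | [/\ forall v, 0 <= t v, \sum_v t v = 1 &
               face K [set v | t v != 0]%SET] ].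

Definition realization_space : topologicalType := set_type realization.

End GeometricRealization.

Arguments realization R {V} K.
Arguments realization_space R {V} K.

Section Rips.
Context (R : realType) (n : nat).
Local Notation E := 'rV[R]_n.

(* The norm of the library on 'rV[R]_n is the sup norm: it induces the same
   topology as the Euclidean metric, but not the same diameters. *)
Definition euclidean_dist (x y : E) : R :=
  Num.sqrt (\sum_(i < n) (x ord0 i - y ord0 i) ^+ 2).

Definition diam (Y : set E) : \bar R :=
  ereal_sup [set (euclidean_dist z.1 z.2)%:E | z in Y `*` Y].

Context (X : {fset E}).

Definition rips_face : set {set X} :=
  [set Y | Y != finset.set0 /\ (diam (val @` [set` Y]) < 1)%E].

Lemma rips_face_neq0 (Y : {set X}) : rips_face Y -> Y != finset.set0.
Proof. by case. Qed.

Lemma rips_face_sub (Y Z : {set X}) :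
  rips_face Y -> Z \subset Y -> Z != finset.set0 -> rips_face Z.
Proof.
move=> [_ dY] /fintype.subsetP ZY Z0; split=> //; apply: le_lt_trans dY.
apply: ereal_sup_le => _ [[_ _] [[a Za <-] [b Zb <-]] <-].
by exists (val a, val b) => //; split; [exists a|exists b] => //; exact: ZY.
Qed.

Lemma rips_face_vertex (v : X) : rips_face [set v]%SET.
Proof.
split; first by apply/set0Pn; exists v; rewrite finset.inE.
apply: (@le_lt_trans _ _ 0%E); last by rewrite lte_fin.
apply: ge_ereal_sup => _ [[_ _] [[a /= + <-] [b /= + <-]] <-] /=.
move=> /set1P-> /set1P->; rewrite lee_fin /euclidean_dist.
by rewrite big1 ?sqrtr0 // => i _; rewrite subrr expr0n.
Qed.

Definition rips : simplicial_complex X :=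
  SimplicialComplex rips_face_neq0 rips_face_sub rips_face_vertex.

Definition rips_space : topologicalType := realization_space R rips.

Definition affine_ext (t : {ptws X -> R}) : E := \sum_(v : X) t v *: val v.

Definition shadow : set E := affine_ext @` realization R rips.

Definition shadow_space : topologicalType := set_type shadow.

Lemma affine_ext_continuous : continuous affine_ext.
Proof.
have ev v : continuous (fun t : {ptws X -> R} => (t v : R)).
  exact: (@proj_continuous _ (fun=> R) v).
have sc (a : E) : continuous (fun k : R => k *: a).
  exact: scalel_continuous.
apply: continuous_big => [|v _]; last exact: continuous_compose (ev v) (sc _).
exact: add_continuous.
Qed.

Lemma shadowP (t : rips_space) : affine_ext (set_val t) \in shadow.
Proof. by apply/mem_set; exists (set_val t) => //; exact: set_valP. Qed.

Definition rips_proj (t : rips_space) : shadow_space :=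
  exist _ (affine_ext (set_val t)) (shadowP t).

Lemma rips_proj_continuous : continuous rips_proj.
Proof.
apply: continuous_comp_initial => /= t.
apply: (@continuous_comp _ _ _ set_val affine_ext).
  exact: initial_continuous.
exact: affine_ext_continuous.
Qed.

HB.instance Definition _ :=
  isContinuous.Build rips_space shadow_space rips_proj rips_proj_continuous.

End Rips.

Arguments rips_proj {R n} X t.

(* Main.v *)
(* Call a path in the shadow liftable between two points of the Rips complex if
   it is homotopic, rel endpoints, to the projection of a path joining them.

   The heart is that a constant path is liftable between any two points [t], [t']
   of the same fibre. If the two supports have at least six vertices in total,
   an affine dependence moves [t] and [t'] inside their simplices, keeping their
   images equal, until a coordinate vanishes; the motion projects to a segment
   travelled out and back. If they have at most five vertices, one simplex has at
   most two, and some vertex of one of the supports forms a Rips simplex with the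
   whole other support (compare the images on the two sides of a bisecting
   hyperplane): go from [t] to [t'] through that vertex.

   The shadow is a finite union of compact convex sets, hence locally a cone, so
   a short path near [s] deforms to a segment into [s] followed by one out of
   [s]; each segment lies in one simplex, and the fibre over [s] takes care of
   the change of simplex. Connectedness of the unit interval globalizes this. *)
Require Import Defs.
From mathcomp Require Import all_boot all_order all_algebra finmap lra.
From mathcomp Require Import boolp classical_sets functions reals ereal.
From mathcomp Require Import topology normedtype homotopy.

Set Implicit Arguments.
Unset Strict Implicit.
Unset Printing Implicit Defensive.

Import Order.TTheory GRing.Theory Num.Theory.
Import numFieldNormedType.Exports.

Local Open Scope ring_scope.

(** * Simplices with intersecting convex hulls *)

(** Convertible with the set that [realization] requires to be a face. *)
Definition supp (R : realType) (V : finType) (t : V -> R) : {set V} :=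
  [set v | t v != 0].

Section SquaredDistance.
Context {R : realType} {n : nat}.
Local Notation E := 'rV[R]_n.

Definition sqdist (x y : E) : R := \sum_(i < n) (x ord0 i - y ord0 i) ^+ 2.

Lemma sqdist_ge0 (x y : E) : 0 <= sqdist x y.
Proof. by apply: sumr_ge0 => i _; exact: sqr_ge0. Qed.

Lemma sqdistC (x y : E) : sqdist x y = sqdist y x.
Proof. by apply: eq_bigr => i _; rewrite -sqrrN opprB. Qed.

Lemma sqdistxx (x : E) : sqdist x x = 0.
Proof. by rewrite /sqdist big1 // => i _; rewrite subrr expr0n. Qed.

(** The quadratic terms in the variable point cancel, so the difference of its squared distances to
    [b] and [c] is an affine function of that point. *)
Lemma sqdistB_affine (I : finType) (w : I -> R) (z : I -> E) (b c : E) :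
  \sum_i w i = 1 ->
  \sum_i w i * (sqdist (z i) b - sqdist (z i) c) =
  sqdist (\sum_i w i *: z i) b - sqdist (\sum_i w i *: z i) c.
Proof.
move=> w1.
have sqdistB x : sqdist x b - sqdist x c =
    \sum_(j < n) (x ord0 j * (2 * (c ord0 j - b ord0 j))
                  + (b ord0 j ^+ 2 - c ord0 j ^+ 2)).
  by rewrite -sumrB; apply: eq_bigr => j _; rewrite !expr2; lra.
under eq_bigr do rewrite sqdistB mulr_sumr.
rewrite exchange_big sqdistB /=; apply: eq_bigr => j _.
under eq_bigr do rewrite mulrDr mulrA.
rewrite big_split -!mulr_suml w1 mul1r; congr (_ * _ + _).
by rewrite summxE; apply: eq_bigr => i _; rewrite mxE.
Qed.

End SquaredDistance.

Section ConvexCombination.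
Context {R : realType} {V : finType} (w h : V -> R) (k : R).
Hypotheses (w0 : forall v, 0 <= w v) (w1 : \sum_v w v = 1).

Lemma convex_comb_ge : {in supp w, forall v, k <= h v} -> k <= \sum_v w v * h v.
Proof.
move=> kh; rewrite -[k]mul1r -w1 mulr_suml; apply: ler_sum => v _.
have [->|wv] := eqVneq (w v) 0; first by rewrite !mul0r.
by rewrite ler_wpM2l // kh // inE.
Qed.

Lemma convex_comb_lt : {in supp w, forall v, h v <= k} ->
  (exists2 v, v \in supp w & h v < k) -> \sum_v w v * h v < k.
Proof.
move=> hk [v vw hv]; rewrite -[k]mul1r -w1 mulr_suml.
rewrite (bigD1 v) // [ltRHS](bigD1 v) //=; apply: ltr_leD.
  by move: vw; rewrite inE => vw; rewrite ltr_pM2l // lt_neqAle eq_sym vw w0.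
apply: ler_sum => x _; have [->|wx] := eqVneq (w x) 0; first by rewrite !mul0r.
by rewrite ler_wpM2l // hk // inE.
Qed.

End ConvexCombination.

Section RipsFaces.
Context {R : realType} {n : nat} (X : {fset 'rV[R]_n}).
Implicit Types (t u : X -> R) (v w : X) (Y : {set X}).

(** [Y] is finite, so the supremum of its distances is bounded by the maximum [M], and the strict
    pairwise bound survives. *)
Lemma rips_faceP Y : face (rips X) Y <->
  Y != finset.set0 /\ {in Y &, forall v w, sqdist (val v) (val w) < 1}.
Proof.
have dist_lt1 v w : (euclidean_dist (val v) (val w) < 1) = (sqdist (val v) (val w) < 1).
  by rewrite -[X in _ < X = _]sqrtr1 ltr_sqrt.
split=> -[Y0 dY]; split=> //.
  move=> v w vY wY; rewrite -dist_lt1 -lte_fin; apply: le_lt_trans dY.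
  apply: ereal_sup_ubound; exists (val v, val w) => //.
  by split; [exists v|exists w].
pose M := \big[Num.max/0]_(z in finset.setX Y Y) euclidean_dist (val z.1) (val z.2).
apply: (@le_lt_trans _ _ M%:E).
  apply: ge_ereal_sup => _ [[_ _] [[v vY <-] [w wY <-]] <-] /=.
  rewrite lee_fin /M (bigmax_sup (v, w)) //=.
  by rewrite finset.in_setX; apply/andP.
rewrite lte_fin; apply: bigmax_lt => // -[v w]; rewrite finset.in_setX => /andP[vY wY].
by rewrite dist_lt1 dY.
Qed.

Lemma rips_face_cone v Y : face (rips X) Y ->
  {in Y, forall w, sqdist (val v) (val w) < 1} -> face (rips X) (v |: Y).
Proof.
move=> /rips_faceP[_ dY] vY; apply/rips_faceP; split.
  by apply/set0Pn; exists v; rewrite setU11.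
move=> a b /setU1P[->|aY] /setU1P[->|bY].
- by rewrite sqdistxx.
- exact: vY.
- by rewrite sqdistC vY.
- exact: dY.
Qed.

Lemma affine_ext_sqdistB t b c : \sum_v t v = 1 ->
  \sum_v t v * (sqdist (val v) b - sqdist (val v) c) =
  sqdist (affine_ext t) b - sqdist (affine_ext t) c.
Proof. exact: sqdistB_affine. Qed.

(** If [w] in [supp u] were far from [v], the function [h] would be at least [1] at the common image
    computed along [t], but less than [1] computed along [u], whose vertices are all close to
    [w]. *)
Lemma vertex_cone t u :
  realization R (rips X) t -> realization R (rips X) u ->
  affine_ext t = affine_ext u -> #|supp t| = 1%N ->
  exists2 v, v \in supp t & face (rips X) (v |: supp u).
Proof.
move=> [t0 t1 ft] [u0 u1 fu] tu /eqP/cards1P[v vt].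
have vin : v \in supp t by rewrite vt set11.
exists v => //; apply: rips_face_cone => // w wu; rewrite ltNge; apply/negP => vw.
have /rips_faceP[_ du] := fu.
pose h (x : X) := sqdist (val x) (val w) - sqdist (val x) (val v).
suff : (1 : R) < 1 by rewrite ltxx.
apply: (@le_lt_trans _ _ (\sum_x t x * h x)).
  apply: convex_comb_ge => // x; rewrite vt => /set1P->.
  by rewrite /h sqdistxx subr0.
rewrite affine_ext_sqdistB // tu -affine_ext_sqdistB //.
have h1 x : x \in supp u -> h x < 1.
  by move=> xu; rewrite ltrBlDr ltr_wpDr ?sqdist_ge0 ?du.
by apply: convex_comb_lt => // [x xu|]; [exact/ltW/h1|exists w => //; exact: h1].
Qed.

(* The bisecting function [|x - b|^2 - |x - c|^2] would be negative at the
   common image, computed along [t], and nonnegative, computed along [u]. *)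
Lemma edge_alternative t u a b c :
  realization R (rips X) t -> realization R (rips X) u ->
  affine_ext t = affine_ext u -> supp t = [set a; b]%SET -> c \in supp u ->
  1 <= sqdist (val a) (val c) ->
  exists w, [/\ w \in supp u, w != c & sqdist (val b) (val w) < 1].
Proof.
move=> [t0 t1 ft] [u0 u1 fu] tu tab cu ac.
have /rips_faceP[_ dt] := ft; have /rips_faceP[_ du] := fu.
apply: contrapT => nw.
have bw w : w \in supp u -> w != c -> 1 <= sqdist (val b) (val w).
  by move=> wu wc; rewrite leNgt; apply/negP => ?; apply: nw; exists w.
have ain : a \in supp t by rewrite tab !inE eqxx.
have bin : b \in supp t by rewrite tab !inE eqxx orbT.
pose h (x : X) := sqdist (val x) (val b) - sqdist (val x) (val c).
suff : (0 : R) < 0 by rewrite ltxx.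
apply: (@le_lt_trans _ _ (\sum_x u x * h x)).
  apply: convex_comb_ge => // x xu; rewrite subr_ge0.
  have [->|xc] := eqVneq x c; first by rewrite sqdistxx sqdist_ge0.
  by apply: le_trans (ltW (du _ _ xu cu)) _; rewrite sqdistC bw.
rewrite affine_ext_sqdistB // -tu -affine_ext_sqdistB //.
have ha : h a < 0 by rewrite subr_lt0; apply: lt_le_trans (dt _ _ ain bin) ac.
apply: convex_comb_lt => //; last by exists a.
move=> x; rewrite tab => /set2P[->|->]; first exact: ltW.
by rewrite /h sqdistxx sub0r oppr_le0 sqdist_ge0.
Qed.

(** A common element of [near_ a] and [near_ b] cones off the edge, and [near_ v] equal to [supp u]
    makes [v] a cone vertex. Otherwise the two sets are disjoint with at least two elements each,
    too many for [supp u]. *)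
Lemma edge_cone t u :
  realization R (rips X) t -> realization R (rips X) u ->
  affine_ext t = affine_ext u -> #|supp t| = 2%N -> (#|supp u| <= 3)%N ->
  (exists2 v, v \in supp t & face (rips X) (v |: supp u)) \/
  (exists2 w, w \in supp u & face (rips X) (w |: supp t)).
Proof.
move=> rt ru tu /eqP/cards2P[a [b [ab tab]]] cu.
pose near_ v := [set w in supp u | sqdist (val v) (val w) < 1]%SET.
have [[_ _ ft] [_ _ fu]] := (rt, ru).
have cone v : v \in supp t -> near_ v = supp u ->
    exists2 v, v \in supp t & face (rips X) (v |: supp u).
  move=> vt nv; exists v => //; apply: rips_face_cone => // w.
  by rewrite -nv inE => /andP[].
have sub v : near_ v \subset supp u by apply/fintype.subsetP => w; rewrite inE => /andP[].
have [nab|/set0Pn[w]] := eqVneq (near_ a :&: near_ b) finset.set0; last first.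
  rewrite !inE => /andP[/andP[wu aw] /andP[_ bw]]; right; exists w; first by rewrite inE.
  apply: rips_face_cone => // x; rewrite -/(supp t) tab.
  by move=> /set2P[->|->]; rewrite sqdistC.
left; apply: contrapT => nc.
have two v v' : supp t = [set v; v']%SET -> near_ v :&: near_ v' = finset.set0 ->
    (1 < #|near_ v'|)%N.
  move=> tvv nvv.
  have far c : c \in supp u -> c \notin near_ v ->
      exists2 w, w \in near_ v' & w != c.
    move=> cu'; rewrite inE cu' /= -leNgt => vc.
    have [w [wu wc vw]] := edge_alternative rt ru tu tvv cu' vc.
    by exists w => //; rewrite inE wu.
  have /fintype.subsetPn[c cu' cv] : ~~ (supp u \subset near_ v).
    apply/negP => uv; apply/nc/(@cone v); first by rewrite tvv !inE eqxx.
    by apply/eqP; rewrite finset.eqEsubset sub.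
  have [w wv' _] := far c cu' cv.
  (* [w] is near [v'], hence by disjointness not near [v]: [far] applies to [w] itself and yields a
     second vertex near [v']. *)
  have [|w' w'v' ww'] := far w (fintype.subsetP (sub v') w wv').
    apply/negP => wv; suff : w \in finset.set0 by rewrite inE.
    by rewrite -nvv inE wv.
  by rewrite (cardD1 w) wv' (cardD1 w') inE ww' w'v'.
have na := two b a; have nb := two a b tab nab.
move: na; rewrite finset.setUC tab finset.setIC => /(_ erefl nab) na.
have : (#|near_ a :|: near_ b| <= #|supp u|)%N.
  by apply/subset_leq_card; rewrite finset.subUset !sub.
rewrite cardsU nab cards0 subn0 => /leq_trans/(_ cu); apply/negP.
by rewrite -ltnNge (leq_add na nb).
Qed.

(** With at most five vertices in all, the smaller support has one or two, and if it has two the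
    other has at most three. *)
Lemma low_dimensional_cone t u :
  realization R (rips X) t -> realization R (rips X) u ->
  affine_ext t = affine_ext u -> (#|supp t| + #|supp u| <= 5)%N ->
  (exists2 v, v \in supp t & face (rips X) (v |: supp u)) \/
  (exists2 w, w \in supp u & face (rips X) (w |: supp t)).
Proof.
wlog tu : t u / (#|supp t| <= #|supp u|)%N => [th|] rt ru ptu card5.
  have [|/ltnW] := leqP #|supp t| #|supp u|; first by move=> ?; exact: th.
  by move=> /th/(_ ru rt (esym ptu)); rewrite addnC => /(_ card5)[]; [right|left].
have t0 : (0 < #|supp t|)%N.
  by case: rt => _ _ /(@face_neq0 _ (rips X)); rewrite card_gt0.
have [t1|t1] := eqVneq #|supp t| 1%N; first by left; exact: vertex_cone.
have t2 : #|supp t| = 2%N.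
  apply/eqP; rewrite eqn_leq [(1 < _)%N]ltn_neqAle eq_sym t1 t0 !andbT leqNgt.
  apply/negP => t3.
  move: card5; apply/negP; rewrite -ltnNge.
  exact: (@leq_add 3 3) t3 (leq_trans t3 tu).
by apply: edge_cone => //; move: card5; rewrite t2.
Qed.

End RipsFaces.

(** * Affine dependences and shrinking of supports *)

Section AffineDependence.
Context {R : realType} {T : finType}.
Implicit Types (t d : T -> R).

Lemma linear_dependence (n : nat) (A : {set T}) (h : T -> 'rV[R]_n) :
  (n < #|A|)%N ->
  exists d, [/\ exists i, d i != 0, supp d \subset A & \sum_i d i *: h i = 0].
Proof.
move=> nA; pose M := \matrix_(i < #|A|) h (enum_val i).
(* The rank of [M] is at most [n], less than its number of rows. The relation [x] is then extended
   by zero outside [A]. *)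
have /rowV0Pn[x /sub_kermxP xM x0] : kermx M != 0.
  rewrite -mxrank_eq0 mxrank_ker -lt0n subn_gt0.
  by apply: leq_ltn_trans nA; exact: rank_leq_col.
have [a aA] : exists a, a \in A by apply/card_gt0P; exact: leq_ltn_trans nA.
pose d i := if i \in A then x ord0 (enum_rank_in aA i) else 0.
have dE j : d (enum_val j) = x ord0 j by rewrite /d enum_valP enum_valK_in.
exists d; split.
- have /rV0Pn[j xj] := x0; exists (enum_val j); by rewrite dE.
- by apply/fintype.subsetP => i; rewrite inE /d; case: ifP => //; rewrite eqxx.
- rewrite -[RHS]xM mulmx_sum_row (bigID (mem A)) /= [X in _ + X]big1 ?addr0; last first.
    by move=> i /negPf iA; rewrite /d iA scale0r.
  by rewrite big_enum_val; apply: eq_bigr => j _; rewrite dE rowK.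
Qed.

(** Move along [d] until a coordinate first vanishes: [r] is the least ratio of [t i] to [- d i]
    over the decreasing coordinates. No coordinate enters the support, since [d] vanishes outside
    it. *)
Lemma hit_boundary t d : (forall i, 0 <= t i) -> supp d \subset supp t ->
  (exists i, d i < 0) ->
  exists r, (forall i, 0 <= t i + r * d i) /\
    supp (fun i => t i + r * d i) \proper supp t.
Proof.
move=> t0 dt [i0 di0].
case: (@arg_minP _ _ _ i0 (fun i => d i < 0) (fun i => t i / - d i) di0) => i di imin.
pose r := t i / - d i.
have sub : supp (fun i => t i + r * d i) \subset supp t.
  apply/fintype.subsetP => j; rewrite !inE; apply: contra => /eqP tj.
  have : j \notin supp d by apply: contra (fintype.subsetP dt j) _; rewrite inE tj eqxx.
  by rewrite inE negbK => /eqP->; rewrite tj mulr0 addr0.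
exists r; split=> // [j|].
- have [dj|dj] := ltP (d j) 0; last first.
    by rewrite addr_ge0 // mulr_ge0 // /r divr_ge0 // oppr_ge0 ltW.
  have := imin _ dj; rewrite ler_pdivlMr ?oppr_gt0 // -/r.
  by rewrite mulrN => ?; lra.
- apply/properP; split=> //; exists i.
    apply: (fintype.subsetP dt); by rewrite inE lt_eqF.
  by rewrite inE negbK /r invrN mulrN mulNr divfK ?subrr // lt_eqF.
Qed.

End AffineDependence.

(** Total mass [1] makes the support nonempty, so it is a face as soon as it lies in one. *)
Lemma realizationW (R : realType) (V : finType) (K : simplicial_complex V)
    (t : V -> R) (Y : {set V}) :
  (forall v, 0 <= t v) -> \sum_v t v = 1 -> face K Y -> supp t \subset Y ->
  realization R K t.
Proof.
move=> t0 t1 fY tY; split=> //; apply: face_sub fY tY _.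
apply/eqP => st; have := oner_neq0 R; rewrite -t1 big1 ?eqxx // => v _.
by apply/eqP; rewrite -[_ == _]negbK; have := finset.in_set0 v; rewrite -st inE => ->.
Qed.

Section Shrinking.
Context {R : realType} {n : nat} (X : {fset 'rV[R]_n}).
Implicit Types t u : X -> R.

(* A pair [t, u] is read as one nonnegative function on [X + X]: beyond [n + 2]
   support points, some direction keeps both total masses and the difference of
   the two images constant. *)
Lemma shrink_pair t u :
  realization R (rips X) t -> realization R (rips X) u ->
  affine_ext t = affine_ext u -> (n + 2 < #|supp t| + #|supp u|)%N ->
  exists t' u', [/\ realization R (rips X) t' /\ realization R (rips X) u',
    affine_ext t' = affine_ext u', supp t' \subset supp t, supp u' \subset supp u
    & (#|supp t'| + #|supp u'| < #|supp t| + #|supp u|)%N].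
Proof.
move=> [t0 t1 ft] [u0 u1 fu] tu card_gt.
pose w (i : X + X) := match i with inl v => t v | inr v => u v end.
have w0 i : 0 <= w i by case: i.
have card_supp (f : X + X -> R) : #|supp f| =
    (#|supp (fun v => f (inl v))| + #|supp (fun v => f (inr v))|)%N.
  rewrite -!sum1_card big_mkcond big_sumType /= [in RHS]big_mkcond /=.
  rewrite [X in (_ = _ + X)%N]big_mkcond /=.
  by congr (_ + _)%N; apply: eq_bigr => v _; rewrite !inE.
(* The last two columns record the masses on the two copies of [X] separately; the sign makes the
   first [n] columns record the difference of the two images. *)
pose h (i : X + X) : 'rV[R]_(n + 2) := match i with
  | inl v => row_mx (val v) (delta_mx ord0 ord0)
  | inr v => row_mx (- val v) (delta_mx ord0 ord_max) end.
have [|d [[i0 di0] dw dh]] := @linear_dependence R _ (n + 2) (supp w) h.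
  by rewrite card_supp.
move: dh; rewrite big_sumType /= => dh.
have dval : \sum_v d (inl v) *: val v = \sum_v d (inr v) *: val v.
  apply/eqP; rewrite -subr_eq0 -sumrN; apply/eqP.
  have := congr1 lsubmx dh; rewrite linearD !linear_sum linear0 /= => lh.
  rewrite -[RHS]lh; congr (_ + _); apply: eq_bigr => v _;
    by rewrite [lsubmx _]linearZ /= row_mxKl ?scalerN.
have dr (k : 'I_2) : \sum_v d (inl v) * (k == ord0)%:R +
    \sum_v d (inr v) * (k == ord_max)%:R = 0.
  have := congr1 (fun M : 'rV_(n + 2) => rsubmx M ord0 k) dh.
  rewrite linearD !linear_sum linear0 /= !mxE !summxE => kh.
  rewrite -[RHS]kh; congr (_ + _); apply: eq_bigr => v _;
    by rewrite [rsubmx _]linearZ /= row_mxKr !mxE eqxx.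
have dl0 : \sum_v d (inl v) = 0.
  have := dr ord0; rewrite [X in _ + X]big1 ?addr0 => [lh|v _]; last by rewrite mulr0.
  by rewrite -[RHS]lh; apply: eq_bigr => v _; rewrite mulr1.
have dr0 : \sum_v d (inr v) = 0.
  have := dr ord_max; rewrite [X in X + _]big1 ?add0r => [rh|v _]; last by rewrite mulr0.
  by rewrite -[RHS]rh; apply: eq_bigr => v _; rewrite mulr1.
(* A nonnegative [d] would vanish, as its sum over each copy of [X] is zero. *)
have dneg : exists i, d i < 0.
  apply: contrapT => nd; have d0 i : 0 <= d i.
    by rewrite leNgt; apply/negP => ?; apply: nd; exists i.
  case: i0 di0 => v; rewrite ?(psumr_eq0P _ dl0) ?(psumr_eq0P _ dr0) ?eqxx // => *;
    exact: d0.
have [r [rw0 rw]] := hit_boundary w0 dw dneg.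
pose w' i := w i + r * d i.
have ssub i : w' i != 0 -> w i != 0.
  by have := fintype.subsetP (proper_sub rw) i; rewrite !inE.
exists (fun v => w' (inl v)), (fun v => w' (inr v)); split.
- split; [apply: (realizationW _ _ ft)|apply: (realizationW _ _ fu)].
  + by move=> v; exact: rw0.
  + by rewrite /w' big_split /= t1 -mulr_sumr dl0 mulr0 addr0.
  + by apply/fintype.subsetP => v; rewrite !inE => /ssub.
  + by move=> v; exact: rw0.
  + by rewrite /w' big_split /= u1 -mulr_sumr dr0 mulr0 addr0.
  + by apply/fintype.subsetP => v; rewrite !inE => /ssub.
- have extE (f : X -> R) (g : X -> R) :
      affine_ext (fun v => f v + r * g v) = affine_ext f + r *: \sum_v g v *: val v.
    rewrite /affine_ext scaler_sumr -big_split; apply: eq_bigr => v _ /=.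
    by rewrite scalerDl scalerA.
  by rewrite /w' !extE dval tu.
- by apply/fintype.subsetP => v; rewrite !inE => /ssub.
- by apply/fintype.subsetP => v; rewrite !inE => /ssub.
- by have := proper_card rw; rewrite !card_supp.
Qed.

End Shrinking.

(** * Homotopies of paths *)

Section UntypedPaths.
Context {R : realType} {T : topologicalType}.
Local Notation I := (unit_itv R).
Implicit Types f g h : I -> T.

(* Homotopy of paths relative to the endpoints, for plain functions: the
   endpoints are not part of the type. *)
Definition rel_homotopic f g : Prop :=
  exists H : I * I -> T,
    [/\ continuous H,
        forall s, H (s, zero) = f s,
        forall s, H (s, one) = g s,
        forall t, H (zero, t) = f zero &
        forall t, H (one, t) = f one].

Lemma rel_homotopic_refl f : continuous f -> rel_homotopic f f.
Proof.
move=> cf; exists (f \o fst); split=> // z.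
by apply: continuous_comp; [exact: cvg_fst|exact: cf].
Qed.

Lemma rel_homotopic_ends f g : rel_homotopic f g -> g zero = f zero /\ g one = f one.
Proof. by case=> H [_ _ Hg H0 H1]; rewrite -!Hg H0 H1. Qed.

Lemma rel_homotopic_continuous f g :
  rel_homotopic f g -> continuous f /\ continuous g.
Proof.
case=> H [cH Hf Hg _ _].
have cslice (t : I) : continuous (fun s : I => H (s, t)).
  apply: (continuous_compose _ cH); apply: continuous_pair => s.
    exact: cvg_id.
  exact: cst_continuous.
have -> : f = fun s => H (s, zero) by apply/funext => s; rewrite Hf.
have -> : g = fun s => H (s, one) by apply/funext => s; rewrite Hg.
by split; exact: cslice.
Qed.

Section Packing.
Context (x y : T) (f g : I -> T) (cf : continuous f) (cg : continuous g).
Context (f0 : f zero = x) (f1 : f one = y) (g0 : g zero = x) (g1 : g one = y).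

(** Carries the results on typed paths over to plain functions. *)
Lemma rel_homotopicP : rel_homotopic f g <->
  homotopic (mk_path cf f0 f1 : {path I from x to y})
            (mk_path cg g0 g1 : {path I from x to y}).
Proof.
split=> -[H [cH Hf Hg H0 H1]]; exists H; split=> //.
- by move=> t; rewrite H0.
- by move=> t; rewrite H1.
- by move=> t; rewrite H0 f0.
- by move=> t; rewrite H1 f1.
Qed.

End Packing.

Lemma rel_homotopic_trans f g h :
  rel_homotopic f g -> rel_homotopic g h -> rel_homotopic f h.
Proof.
move=> fg gh; have [cf cg] := rel_homotopic_continuous fg.
have [_ ch] := rel_homotopic_continuous gh.
have [g0 g1] := rel_homotopic_ends fg; have [h0 h1] := rel_homotopic_ends gh.
have /(rel_homotopicP cf cg erefl erefl g0 g1) fg' := fg.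
have /(rel_homotopicP cg ch g0 g1 (etrans h0 g0) (etrans h1 g1)) gh' := gh.
apply/(rel_homotopicP cf ch erefl erefl (etrans h0 g0) (etrans h1 g1)).
exact: homotopic_trans fg' gh'.
Qed.

Lemma cat_continuous f g : continuous f -> continuous g -> f one = g zero ->
  continuous (cat_fun f g).
Proof.
move=> cf cg fg.
pose a : {path I from f zero to g zero} := mk_path cf erefl fg.
pose b : {path I from g zero to g one} := mk_path cg erefl erefl.
exact: (@cat_fun_continuous _ _ _ _ _ a b).
Qed.

Lemma cat_zero f g : cat_fun f g zero = f zero.
Proof. by rewrite /cat_fun itv_val0 mulr0 invr_ge0 ler0n clamp_le0. Qed.

Lemma cat_one f g : cat_fun f g one = g one.
Proof.
rewrite /cat_fun itv_val1 mulr1 ifF; last by apply/negbTE; rewrite -ltNge; lra.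
by rewrite clamp_ge1 //; lra.
Qed.

Lemma rel_homotopic_cat f f' g g' : f one = g zero ->
  rel_homotopic f f' -> rel_homotopic g g' ->
  rel_homotopic (cat_fun f g) (cat_fun f' g').
Proof.
move=> fg ff gg; have [cf cf'] := rel_homotopic_continuous ff.
have [cg cg'] := rel_homotopic_continuous gg.
have [f0 f1] := rel_homotopic_ends ff; have [g0 g1] := rel_homotopic_ends gg.
have /(rel_homotopicP cf cf' erefl fg f0 (etrans f1 fg)) ff' := ff.
have /(rel_homotopicP cg cg' erefl erefl g0 g1) gg' := gg.
have [H [cH Hf Hg H0 H1]] := homotopic_cat ff' gg'.
exists H; split=> //.
- by move=> t; rewrite H0 cat_zero.
- by move=> t; rewrite H1 cat_one.
Qed.

End UntypedPaths.

(** Turns a concatenation in the shadow into the image of one path in a parameter space, where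
    [rel_homotopic_convex] applies. *)
Lemma comp_cat_fun (R : realType) (S T : topologicalType) (G : S -> T)
    (a b : unit_itv R -> S) :
  G \o cat_fun a b = cat_fun (G \o a) (G \o b).
Proof. by apply/funext => s; rewrite /cat_fun /=; case: ifP. Qed.

Lemma continuous_segment (R : realType) (W : normedModType R)
    (S : topologicalType) (k : S -> R) (a b : S -> W) :
  continuous k -> continuous a -> continuous b ->
  continuous (fun s => (1 - k s) *: a s + k s *: b s).
Proof.
move=> ck ca cb s; apply: cvgD; apply: cvgZ; [|exact: ca|exact: ck|exact: cb].
exact: (continuous_subl ck).
Qed.

(** The straight-line homotopy in [W], pushed forward by [G]. Below, [W] is the real line or the
    plane. *)
Lemma rel_homotopic_convex (R : realType) (W : normedModType R)
    (T : topologicalType) (G : W -> T) (a b : unit_itv R -> W) :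
  continuous G -> continuous a -> continuous b ->
  a zero = b zero -> a one = b one -> rel_homotopic (G \o a) (G \o b).
Proof.
move=> cG ca cb ab0 ab1.
pose m (z : unit_itv R * unit_itv R) :=
  (1 - itv_val z.2) *: a z.1 + itv_val z.2 *: b z.1.
have c2 : continuous (fun z : unit_itv R * unit_itv R => itv_val z.2).
  exact: itv_val_snd_continuous.
have c1 (c : unit_itv R -> W) :
    continuous c -> continuous (fun z : unit_itv R * unit_itv R => c z.1).
  by move=> cc; apply: continuous_compose cc => z; exact: cvg_fst.
exists (G \o m); split=> [z|s|s|t|t] /=.
- apply: continuous_comp; last exact: cG.
  by apply: continuous_segment; [exact: c2|exact: c1|exact: c1].
- by rewrite /m /= itv_val0 subr0 scale1r scale0r addr0.
- by rewrite /m /= itv_val1 subrr scale1r scale0r add0r.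
- by rewrite /m /= -ab0 -scalerDl subrK scale1r.
- by rewrite /m /= -ab1 -scalerDl subrK scale1r.
Qed.

(** * Local structure of the shadow *)

Local Open Scope classical_set_scope.

Lemma ptws_continuous (R : realType) (A : topologicalType) (V : choiceType)
    (F : A -> {ptws V -> R}) :
  (forall v, continuous (fun a => F a v : R)) -> continuous F.
Proof.
move=> cF a; apply/cvg_sup => v.
exact: (@continuous_comp_initial _ _ _ (fun f : {ptws V -> R} => f v) F (cF v)).
Qed.

Section Subspaces.
Context {R : realType} {n : nat} (X : {fset 'rV[R]_n}).
Local Notation I := (unit_itv R).

Lemma shadow_lift (A : topologicalType) (F : A -> 'rV[R]_n) :
  continuous F -> (forall a, shadow X (F a)) ->
  exists2 G : A -> shadow_space X, continuous G & forall a, set_val (G a) = F a.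
Proof.
move=> cF sF; exists (fun a => exist _ (F a) (mem_set (sF a))) => //.
exact: continuous_comp_initial.
Qed.

Lemma rips_lift (A : topologicalType) (F : A -> {ptws X -> R}) :
  (forall v, continuous (fun a => F a v : R)) ->
  (forall a, realization R (rips X) (F a)) ->
  exists2 G : A -> rips_space X, continuous G & forall a, set_val (G a) = F a.
Proof.
move=> cF rF; exists (fun a => exist _ (F a) (mem_set (rF a))) => //.
by apply: continuous_comp_initial; exact: ptws_continuous.
Qed.

Lemma realization_segment (K : simplicial_complex X) (Y : {set X})
    (t u : X -> R) (k : R) :
  realization R K t -> realization R K u -> face K Y ->
  supp t \subset Y -> supp u \subset Y -> 0 <= k <= 1 ->
  realization R K (fun v => (1 - k) * t v + k * u v).
Proof.
move=> [t0 t1 _] [u0 u1 _] fY tY uY /andP[k0 k1]; apply: (realizationW _ _ fY).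
- by move=> v; rewrite addr_ge0 ?mulr_ge0 ?subr_ge0.
- by rewrite big_split /= -!mulr_sumr t1 u1 !mulr1 subrK.
- apply/fintype.subsetP => v; rewrite inE; apply: contraNT => vY.
  have /negPf := contra (fintype.subsetP tY v) vY.
  have /negPf := contra (fintype.subsetP uY v) vY.
  by rewrite !inE => /negbFE/eqP-> /negbFE/eqP->; rewrite !mulr0 addr0.
Qed.

Lemma affine_ext_segment (t u : X -> R) (k : R) :
  affine_ext (fun v => (1 - k) * t v + k * u v) =
  (1 - k) *: affine_ext t + k *: affine_ext u.
Proof.
rewrite /affine_ext !scaler_sumr -big_split; apply: eq_bigr => v _ /=.
by rewrite !scalerA -scalerDl.
Qed.

End Subspaces.

Section Simplices.
Context {R : realType} {n : nat} (X : {fset 'rV[R]_n}).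

(** The image under [affine_ext] is the convex hull of [Y]. *)
Definition face_points (Y : {set X}) : set {ptws X -> R} :=
  [set t | [/\ forall v, 0 <= t v, \sum_v t v = 1 & supp t \subset Y]].

(** A closed part of a cube, which is compact by Tychonoff's theorem. *)
Lemma face_points_compact Y : compact (face_points Y).
Proof.
have coord v : continuous (fun t : {ptws X -> R} => t v : R).
  exact: (@proj_continuous _ (fun=> R) v).
pose cube : set {ptws X -> R} := [set t | forall v, `[0, 1]%classic (t v)].
have cube_compact : compact cube.
  by apply: (@tychonoff _ (fun=> R) (fun=> `[0, 1]%classic)) => v; exact: segment_compact.
pose pinned : set {ptws X -> R} :=
  [set t | \sum_v t v = 1] `&` \bigcap_(v in [set v | v \notin Y]) [set t | t v = 0].
have pinned_closed : closed pinned.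
  apply: closedI.
    apply: (closed_comp (f := fun t : {ptws X -> R} => \sum_v t v) _ (@closed_eq R 1)).
    move=> t _; apply: continuous_big => [|v _]; [exact: add_continuous|exact: coord].
  apply: closed_bigI => v _.
  apply: (closed_comp (f := fun t : {ptws X -> R} => t v : R) _ (@closed_eq R 0)).
  by move=> t _; exact: coord.
suff -> : face_points Y = cube `&` pinned by exact: compact_closedI.
apply/seteqP; split=> [t [t0 t1 tY]|t [t01 [t1 tY]]].
  split; last first.
    split=> // v /= vY; apply/eqP; apply: contraNT vY => tv.
    by apply: (fintype.subsetP tY); rewrite inE.
  move=> v /=; rewrite in_itv /= t0 -t1 (bigD1 v) //= lerDl.
  by apply: sumr_ge0 => w _; exact: t0.
split=> // [v|].
  by have := t01 v; rewrite /= in_itv /= => /andP[].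
apply/fintype.subsetP => v; rewrite inE; apply: contraNT => vY.
by apply/eqP/tY.
Qed.

(* Points of the shadow close to [s] lie only on simplices through [s], since
   the finitely many other simplices are compact: the shadow is locally a cone. *)
Lemma simplices_near (s : 'rV[R]_n) :
  \forall z \near s, forall Y : {set X},
    (@affine_ext R n X @` face_points Y) z -> (@affine_ext R n X @` face_points Y) s.
Proof.
pose conv Y := @affine_ext R n X @` face_points Y.
apply: (@filter_forall _ {set X} (fun Y z => conv Y z -> conv Y s) (nbhs s)) => Y.
rewrite /conv.
have [Ys|Ys] := pselect ((@affine_ext R n X @` face_points Y) s).
  exact: nearW.
have cl : closed (@affine_ext R n X @` face_points Y).
  apply: compact_closed; first exact: norm_hausdorff.
  apply: continuous_compact (@face_points_compact Y).
  exact: continuous_subspaceT (@affine_ext_continuous _ _ _).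
have : nbhs s (~` (@affine_ext R n X @` face_points Y)).
  by apply: open_nbhs_nbhs; split=> //; exact: closed_openC.
by apply: filterS => z nz /nz.
Qed.

End Simplices.

(** * Lifting up to homotopy *)

Section Lifting.
Context {R : realType} {n : nat} (X : {fset 'rV[R]_n}).
Local Notation I := (unit_itv R).
Local Notation E := 'rV[R]_n.
Local Notation p := (@rips_proj R n X).
Implicit Types (t u : rips_space X) (g : I -> shadow_space X).

Definition coords t : X -> R := set_val t.
Definition shadow_val (s : shadow_space X) : E := set_val s.

Lemma coordsP t : realization R (rips X) (coords t).
Proof. exact: set_valP. Qed.

Lemma coords_face t : face (rips X) (supp (coords t)).
Proof. by case: (coordsP t). Qed.

Lemma coordsK (t : X -> R) : realization R (rips X) t -> exists t', coords t' = t.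
Proof. by move=> rt; exists (exist _ t (mem_set rt)). Qed.

Lemma shadow_val_proj t : shadow_val (p t) = affine_ext (coords t).
Proof. by []. Qed.

Lemma shadow_val_inj : injective shadow_val.
Proof. exact: val_inj. Qed.

Lemma shadow_val_continuous : continuous shadow_val.
Proof. exact: initial_continuous. Qed.

(** The continuity of [g] and its endpoints [p t] and [p u] follow from the homotopy, so [g] can be
    a plain function. *)
Definition lifts t u g : Prop :=
  exists c : I -> rips_space X,
    [/\ continuous c, c zero = t, c one = u & rel_homotopic (p \o c) g].

Lemma lifts_homotopic t u g h : rel_homotopic g h -> lifts t u g -> lifts t u h.
Proof.
by move=> gh [c [cc c0 c1 cg]]; exists c; split=> //; exact: rel_homotopic_trans gh.
Qed.

Lemma lifts_cat t u w g h : lifts t u g -> lifts u w h -> lifts t w (cat_fun g h).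
Proof.
move=> [c [cc c0 c1 cg]] [d [cd d0 d1 dh]].
exists (cat_fun c d); rewrite cat_zero cat_one; split=> //.
  by apply: cat_continuous; rewrite ?c1 ?d0.
by rewrite comp_cat_fun; apply: rel_homotopic_cat cg dh; rewrite /= c1 d0.
Qed.

Lemma shadow_segment (Y : {set X}) (t u : X -> R) (k : R) :
  realization R (rips X) t -> realization R (rips X) u -> face (rips X) Y ->
  supp t \subset Y -> supp u \subset Y -> 0 <= k <= 1 ->
  shadow X ((1 - k) *: affine_ext t + k *: affine_ext u).
Proof.
move=> rt ru fY tY uY k01; rewrite -affine_ext_segment.
exists (fun v => (1 - k) * t v + k * u v) => //.
exact: (realization_segment rt ru fY).
Qed.

(** Interpolating barycentric coordinates inside the simplex [Y] gives a path whose projection is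
    [g] itself. *)
Lemma lifts_segment (Y : {set X}) t u g : face (rips X) Y ->
  supp (coords t) \subset Y -> supp (coords u) \subset Y ->
  (forall s, shadow_val (g s) =
     (1 - itv_val s) *: shadow_val (p t) + itv_val s *: shadow_val (p u)) ->
  lifts t u g.
Proof.
move=> fY tY uY gE.
have [||c cc cE] := @rips_lift R n X I (fun s v =>
    (1 - itv_val s) * coords t v + itv_val s * coords u v).
- move=> v.
  by apply: (@continuous_segment R R^o I itv_val (cst (coords t v)) (cst (coords u v)));
    [exact: itv_val_continuous|exact: cst_continuous|exact: cst_continuous].
- move=> s; apply: (realization_segment (coordsP t) (coordsP u) fY) => //.
  exact: itv_val_bound.
have cg : p \o c = g.
  apply/funext => s; apply: shadow_val_inj; rewrite gE /= shadow_val_proj /coords cE.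
  exact: affine_ext_segment.
exists c; split=> //.
- apply: val_inj; apply/funext => v; rewrite -[LHS]/(set_val (c zero) v) cE.
  by rewrite itv_val0 subr0 mul1r mul0r addr0.
- apply: val_inj; apply/funext => v; rewrite -[LHS]/(set_val (c one) v) cE.
  by rewrite itv_val1 subrr mul1r mul0r add0r.
- rewrite -cg; apply: rel_homotopic_refl => s.
  by apply: continuous_comp; [exact: cc|exact: rips_proj_continuous].
Qed.

Lemma clamp_val_bound (k : R) : 0 <= clamp_val k <= 1.
Proof. by rewrite -itv_val_clamp itv_val_bound. Qed.

Lemma clamp_val_itv (s : I) : clamp_val (itv_val s) = itv_val s.
Proof. by rewrite -itv_val_clamp itv_valK. Qed.

Lemma clamp_val_continuous : continuous (@clamp_val R).
Proof.
exact: (continuous_compose clamp_continuous itv_val_continuous).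
Qed.

(* The projected path runs from the common image of [t] and [t'] to that of [u]
   and [u'], waits, and retraces its steps. *)
Lemma lifts_through (Y Y' : {set X}) t u u' t' :
  p t = p t' -> p u = p u' ->
  face (rips X) Y -> supp (coords t) \subset Y -> supp (coords u) \subset Y ->
  face (rips X) Y' -> supp (coords t') \subset Y' -> supp (coords u') \subset Y' ->
  lifts u u' (cst (p u)) -> lifts t t' (cst (p t)).
Proof.
move=> ptt' puu' fY tY uY fY' t'Y' u'Y' luu'.
(* Clamping extends the segment to the whole real line, so that [rel_homotopic_convex] applies to
   [G]. *)
have [||G cG GE] := @shadow_lift R n X R (fun k =>
    (1 - clamp_val k) *: shadow_val (p t) + clamp_val k *: shadow_val (p u)).
- by apply: continuous_segment; [exact: clamp_val_continuous|exact: cst_continuous..].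
- move=> k; apply: (shadow_segment (coordsP t) (coordsP u) fY) => //.
  exact: clamp_val_bound.
have GE' k : shadow_val (G k) = _ := GE k.
have l1 : lifts t u (G \o itv_val).
  by apply: (lifts_segment fY) => // s; rewrite GE' clamp_val_itv.
have l2 : lifts u' t' (G \o (fun s => 1 - itv_val s)).
  apply: (lifts_segment fY') => // s; rewrite GE' -ptt' -puu'.
  have -> : clamp_val (1 - itv_val s) = 1 - itv_val s.
    by rewrite -itv_val_clamp clampE //; have := itv_val_bound s; lra.
  by rewrite subKr addrC.
have G1 : G 1 = p u.
  apply: shadow_val_inj; rewrite GE' -itv_val_clamp clamp_ge1 // itv_val1.
  by rewrite subrr scale0r add0r scale1r.
have G0 : G 0 = p t.
  apply: shadow_val_inj; rewrite GE' -itv_val_clamp clamp_le0 // itv_val0.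
  by rewrite subr0 scale0r addr0 scale1r.
have l := lifts_cat l1 (lifts_cat luu' l2).
apply: lifts_homotopic l.
(* Both sides become images under [G] of loops in the line at [0]: one goes to [1], waits and
   returns, the other is constant. *)
have -> : cst (p u) = G \o cst 1 :> (I -> _) by apply/funext => s; rewrite /= G1.
have -> : cst (p t) = G \o cst 0 :> (I -> _) by apply/funext => s; rewrite /= G0.
rewrite -!comp_cat_fun.
have crev : continuous (fun s : I => 1 - itv_val s).
  exact: (continuous_subl itv_val_continuous).
apply: (@rel_homotopic_convex R R^o) => //.
- apply: cat_continuous; first exact: itv_val_continuous.
    apply: cat_continuous => //; first exact: cst_continuous.
    by rewrite itv_val0 subr0.
  by rewrite cat_zero itv_val1.
- exact: cst_continuous.
- by rewrite cat_zero itv_val0.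
- by rewrite !cat_one itv_val1 subrr.
Qed.

End Lifting.

(** * Fibres of the projection and short paths *)

Section FibersInSpace.
Context {R : realType} (X : {fset 'rV[R]_3}).
Local Notation I := (unit_itv R).
Local Notation p := (@rips_proj R 3 X).
Implicit Types (t u : rips_space X) (s : shadow_space X).

Lemma lifts_cst t : lifts t t (cst (p t)).
Proof.
exists (cst t); split=> //; first exact: cst_continuous.
by apply: rel_homotopic_refl; exact: (@cst_continuous _ _ (p t)).
Qed.

(** [lifts_through] with [u] and [u'] both equal to the vertex [v], where waiting lifts
    trivially. *)
Lemma lifts_via_vertex (Y Y' : {set X}) t t' (v : X) : p t = p t' ->
  face (rips X) Y -> supp (coords t) \subset Y -> v \in Y ->
  face (rips X) Y' -> supp (coords t') \subset Y' -> v \in Y' ->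
  lifts t t' (cst (p t)).
Proof.
move=> ptt' fY tY vY fY' t'Y' vY'.
have supp_delta : supp (fun w => (w == v)%:R : R) \subset [set v]%SET.
  by apply/fintype.subsetP => w; rewrite !inE; have [//|] := eqVneq w v; rewrite eqxx.
have [u uE] : exists u, coords u = (fun w => (w == v)%:R).
  apply: coordsK; apply: (realizationW _ _ (face_vertex (rips X) v)) => //.
  by rewrite (bigD1 v) //= eqxx big1 ?addr0 // => w /negPf->.
have uv (Z : {set X}) : v \in Z -> supp (coords u) \subset Z.
  by rewrite -finset.sub1set uE; exact: fintype.subset_trans.
apply: (lifts_through ptt' erefl fY tY (uv _ vY) fY' t'Y' (uv _ vY')).
exact: lifts_cst.
Qed.

(** Induction on the total number of support points. The dimension enters here: for [n = 3] the
    bound [n + 2] of [shrink_pair] is [5], exactly where [low_dimensional_cone] takes over. *)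
Lemma lifts_fiber t t' : p t = p t' -> lifts t t' (cst (p t)).
Proof.
have [m] := ubnP (#|supp (coords t)| + #|supp (coords t')|)%N.
elim: m => // m IHm in t t' * => card_lt ptt'.
have ext : affine_ext (coords t) = affine_ext (coords t').
  by rewrite -!shadow_val_proj ptt'.
have [card5|card_gt] := leqP (#|supp (coords t)| + #|supp (coords t')|) 5.
  have [[v vt fv]|[v vt' fv]] :=
    low_dimensional_cone (coordsP t) (coordsP t') ext card5.
    by apply: (lifts_via_vertex ptt' (coords_face t) _ vt fv);
      [exact: subxx|exact: finset.subsetUr|exact: setU11].
  by apply: (lifts_via_vertex ptt' fv _ _ (coords_face t') _ vt');
    [exact: finset.subsetUr|exact: setU11|exact: subxx].
have [u0 [u0' [[ru ru'] uu' ut u't' card_lt']]] :=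
  shrink_pair (coordsP t) (coordsP t') ext card_gt.
have [[u uE] [u' u'E]] := (coordsK ru, coordsK ru').
have puu' : p u = p u' by apply: shadow_val_inj; rewrite !shadow_val_proj uE u'E.
apply: (lifts_through ptt' puu' (coords_face t) _ _ (coords_face t')).
- exact: subxx.
- by rewrite uE.
- exact: subxx.
- by rewrite u'E.
- apply: IHm puu'; rewrite uE u'E; exact: leq_trans card_lt' card_lt.
Qed.

(* Near [s] the shadow is a cone with apex [s], so a path staying there is
   homotopic to the straight path into [s] followed by the straight path out,
   and each of the two lives in the image of one simplex. *)
Lemma lifts_local (s : shadow_space X) (f : R -> shadow_space X) a b :
  continuous f -> f 0 = p a -> f 1 = p b ->
  (forall k, 0 <= k <= 1 -> forall Y : {set X},
    (@affine_ext R 3 X @` face_points Y) (shadow_val (f k)) ->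
    (@affine_ext R 3 X @` face_points Y) (shadow_val s)) ->
  lifts a b (f \o itv_val).
Proof.
move=> cf f0 f1 star.
(* [star], applied to the support of [t], provides a point over [s] in the simplex carrying [t]. *)
have foot t : (exists2 k, 0 <= k <= 1 & f k = p t) ->
    exists2 u, p u = s & supp (coords u) \subset supp (coords t).
  move=> [k k01 fk].
  have [|z [z0 z1 zt] zs] := star k k01 (supp (coords t)).
    by exists (coords t); [case: (coordsP t)|rewrite fk].
  have [u uE] := coordsK (realizationW z0 z1 (coords_face t) zt).
  exists u; last by rewrite uE.
  by apply: shadow_val_inj; rewrite shadow_val_proj uE.
have [|a' pa' sa'] := foot a; first by exists 0; rewrite // lexx ler01.
have [|b' pb' sb'] := foot b; first by exists 1; rewrite // lexx ler01.
(* On the unit square, [z.1] is the time along [f] and [z.2] the progress towards [s]: [G (k, 0)] is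
   [f k] and [G (k, 1)] is [s]. *)
have [||G cG GE] := @shadow_lift R 3 X (R^o * R^o)%type (fun z =>
    (1 - clamp_val z.2) *: shadow_val (f (clamp_val z.1)) +
    clamp_val z.2 *: shadow_val s).
- apply: continuous_segment; last exact: cst_continuous.
    by apply: continuous_compose (@clamp_val_continuous R) => z; exact: cvg_snd.
  apply: continuous_compose (@shadow_val_continuous _ _ _).
  apply: continuous_compose cf.
  by apply: continuous_compose (@clamp_val_continuous R) => z; exact: cvg_fst.
- move=> [z1 z2] /=; have [t rt tf] := set_valP (f (clamp_val z1)).
  have [|u [u0 u1 ut] us] := star _ (clamp_val_bound z1) (supp t).
    by exists t => //; case: rt.
  have <- : affine_ext t = shadow_val (f (clamp_val z1)) := tf.
  rewrite -us.
  have [_ _ ft] := rt.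
  apply: (shadow_segment rt (realizationW u0 u1 ft ut) ft) => //.
  exact: clamp_val_bound.
have GE' z : shadow_val (G z) = _ := GE z.
have c0 : clamp_val (0 : R) = 0 by rewrite -itv_val_clamp clampE // lexx ler01.
have c1 : clamp_val (1 : R) = 1 by rewrite -itv_val_clamp clampE // lexx ler01.
have crev (k : I) : clamp_val (1 - itv_val k) = 1 - itv_val k.
  by rewrite -itv_val_clamp clampE //; have := itv_val_bound k; lra.
have l1 : lifts a a' (G \o (fun k : I => (0, itv_val k))).
  apply: (lifts_segment (coords_face a)) => // k.
  by rewrite GE' /= c0 clamp_val_itv f0 pa'.
(* This side of the square is collapsed to [s]; the change of simplex happens in the fibre. *)
have l2 : lifts a' b' (G \o (fun k : I => (itv_val k, 1))).
  have -> : G \o (fun k : I => (itv_val k, 1)) = cst (p a').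
    apply/funext => k; apply: shadow_val_inj.
    by rewrite GE' /= c1 subrr scale0r add0r scale1r pa'.
  by apply: lifts_fiber; rewrite pa' pb'.
have l3 : lifts b' b (G \o (fun k : I => (1, 1 - itv_val k))).
  apply: (lifts_segment (coords_face b)) => // k.
  by rewrite GE' /= c1 crev subKr f1 pb' addrC.
(* The three lifted sides and the remaining side, which is [f], have the same ends in the plane. *)
apply: lifts_homotopic (lifts_cat l1 (lifts_cat l2 l3)).
have -> : f \o itv_val = G \o (fun k : I => (itv_val k, 0)).
  apply/funext => k; apply: shadow_val_inj.
  by rewrite GE' /= c0 subr0 scale1r scale0r addr0 clamp_val_itv.
rewrite -!comp_cat_fun.
have cval := @itv_val_continuous R.
have crev' : continuous (fun k : I => 1 - itv_val k) := continuous_subl cval.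
have cc (x : R) : continuous (fun _ : I => x) by exact: cst_continuous.
apply: (@rel_homotopic_convex R (R^o * R^o)%type) => //.
- apply: cat_continuous; first exact: continuous_pair.
    apply: cat_continuous; [exact: continuous_pair|exact: continuous_pair|].
    by rewrite /= itv_val0 itv_val1 subr0.
  by rewrite cat_zero itv_val0 itv_val1.
- exact: continuous_pair.
- by rewrite cat_zero !itv_val0.
- by rewrite !cat_one !itv_val1 subrr.
Qed.

End FibersInSpace.

(** * Globalization along the unit interval *)

Lemma locally_constant_segment (R : realType) (P : set R) :
  (forall r, exists2 e, 0 < e &
    forall u v, `|r - u| < e -> `|r - v| < e -> P u -> P v) ->
  P 0 -> P 1.
Proof.
move=> loc P0.
(* The local hypothesis makes [P] and its complement open, so [P] meets the connected segment in a
   nonempty clopen part, hence in all of it. *)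
have oP : open P.
  rewrite openE => r Pr; have [e e0 re] := loc r.
  apply/nbhs_ballP; exists e => // v rv; apply: re Pr => //.
  by rewrite subrr normr0.
have cP : closed P.
  rewrite -openC openE => r nPr; have [e e0 re] := loc r.
  apply/nbhs_ballP; exists e => // v rv Pv; apply: nPr; apply: re Pv => //.
  by rewrite subrr normr0.
have in01 (k : R) : 0 <= k <= 1 -> `[0, 1]%classic k by rewrite /= in_itv.
suff [] : (`[0, 1] `&` P) 1 by [].
rewrite (@segment_connected R 0 1 (`[0, 1] `&` P)).
- by apply: in01; rewrite ler01 lexx.
- by exists 0; split=> //; apply: in01; rewrite lexx ler01.
- by exists P.
- by exists P.
Qed.

Section Surjection.
Context {R : realType} (X : {fset 'rV[R]_3}).
Local Notation I := (unit_itv R).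
Local Notation p := (@rips_proj R 3 X).

Lemma rips_proj_surjective (s : shadow_space X) : exists t, p t = s.
Proof.
have [t rt ts] := set_valP s; have [t' tE] := coordsK rt.
by exists t'; apply: shadow_val_inj; rewrite shadow_val_proj tE.
Qed.

Lemma lifts_path (x y : rips_space X) (f : I -> shadow_space X) :
  continuous f -> f zero = p x -> f one = p y -> lifts x y f.
Proof.
move=> cf f0 f1.
(* Extending [f] by constants makes the local condition meaningful at every real [r]. *)
pose g (r : R) : shadow_space X := f (clamp r).
have cg : continuous g := continuous_compose clamp_continuous cf.
have cscale (v : R) : continuous (fun s : I => v * itv_val s).
  exact: continuous_mull itv_val_continuous.
have gconvex (a b : I -> R) : continuous a -> continuous b ->
    a zero = b zero -> a one = b one -> rel_homotopic (g \o a) (g \o b).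
  exact: (@rel_homotopic_convex R R^o).
(* Quantifying over the whole fibre over [g v] leaves the end of the lift free, so it can be matched
   with the start of the next piece. *)
pose P (v : R) := forall t, p t = g v -> lifts x t (g \o (fun s => v * itv_val s)).
suff : P 1.
  move=> /(_ y); rewrite /g clamp_ge1 // => /(_ (esym f1)).
  suff -> : g \o (fun s : I => 1 * itv_val s) = f by [].
  by apply/funext => s; rewrite /g /= mul1r itv_valK.
apply: (@locally_constant_segment _ P); last first.
  move=> t; rewrite /g clamp_le0 // f0 => tx.
  have -> : g \o (fun s : I => 0 * itv_val s) = cst (p x).
    by apply/funext => s; rewrite /g /= mul0r clamp_le0.
  exact: lifts_fiber.
move=> r.
have near_r : \forall z \near r, forall Y : {set X},
    (@affine_ext R 3 X @` face_points Y) (shadow_val (g z)) ->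
    (@affine_ext R 3 X @` face_points Y) (shadow_val (g r)).
  have cgs : continuous (fun z => shadow_val (g z)).
    exact: continuous_compose cg (@shadow_val_continuous _ _ _).
  by have /(cgs r) := simplices_near X (shadow_val (g r)).
have /nbhs_ballP[e e0 re] := near_r; exists e => // u v ru rv Pu t tv.
have [a au] := rips_proj_surjective (g u).
(* [v] may precede [u]; the resulting backtracking is removed by the final homotopy in the line. *)
pose seg (k : R) := u + k * (v - u).
have cseg : continuous seg.
  move=> k; apply: cvgD; first exact: cvg_cst.
  by apply: cvgM; [exact: cvg_id|exact: cvg_cst].
have l : lifts a t ((g \o seg) \o itv_val).
  apply: (@lifts_local _ _ (g r)).
  - exact: continuous_compose cseg cg.
  - by rewrite /= /seg mul0r addr0 au.
  - by rewrite /= /seg mul1r subrKC tv.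
  - move=> k k01; apply: re; rewrite /ball /= ltr_distl /seg.
    move: ru rv k01; rewrite !ltr_distl => /andP[u1 u2] /andP[v1 v2] /andP[k0 k1].
    by have [uv|vu] := leP u v; apply/andP; split; nra.
apply: lifts_homotopic (lifts_cat (Pu a au) l).
rewrite -[(g \o seg) \o _]/(g \o (seg \o itv_val)) -comp_cat_fun.
have csegi : continuous (seg \o itv_val : I -> R).
  exact: continuous_compose itv_val_continuous cseg.
apply: gconvex => //.
- apply: cat_continuous => //.
  by rewrite /= /seg itv_val1 itv_val0 mulr1 mul0r addr0.
- by rewrite cat_zero !itv_val0 !mulr0.
- by rewrite cat_one /= /seg !itv_val1 mul1r mulr1 subrKC.
Qed.

End Surjection.

Theorem theoremI (R : realType) (X : {fset 'rV[R]_3}) :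
  pi1_surjection R (rips_proj X).
Proof.
move=> x b.
(* Both ends of the lift are prescribed to be [x], so the lift of a representative of [b] is a
   loop. *)
have [|||c [cc c0 c1 pcf]] := @lifts_path R X x x (repr b).
- exact: cts_fun.
- exact: path_zero.
- exact: path_one.
exists (pi1_class (mk_path cc c0 c1 : {path unit_itv R from x to x})).
rewrite pi1_map_class -[RHS]pi1_reprK; apply/pi1_classP.
have [H [cH Hf Hg H0 H1]] := pcf.
exists H; split=> // k; [rewrite H0|rewrite H1]; by rewrite /= ?c0 ?c1.
Qed.
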